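(* Let $H=A^*A$ with singular numbers $s_j=s_j(H)$. Suppose that $f_0\in H_\varphi$ for an index function $\varphi$, and that $(\mathcal X_k)_{k\in\mathbb N}$ is a sequence of subspaces of $X$, $\dim\mathcal X_k=k$, with orthogonal projections $P_k$ onto $\mathcal X_k$, for which there are constants $M,C_P,C_B\ge1$ such that for all $k\in\mathbb N$ $$\varrho(H^{1/2},\mathcal X_k)\le C_Ps_{k+1}^{1/2},\qquad j(H^{1/2},\mathcal X_k)\ge\frac1{C_B}s_k^{1/2},\qquad \|(I-P_k)f_0\|_X\le M\varphi(s_{k+1}).$$ Given $\delta>0$ let $$k_\delta:=\max\{j:\ \Theta_\varphi(s_j)>\delta\}.$$ Then there is a constant $C_4$ such that $$\omega_{f_0}(H^{-1/2},\mathcal X_{k_\delta},\delta)\le C_4\,\varphi\big(\Theta_\varphi^{-1}(\delta)\big)$$ for all $\delta>0$ small enough.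
   Context: $X,Y$ are separable Hilbert spaces, $A:X\to Y$ is a compact injective linear operator whose range is not contained in a finite-dimensional subspace, $H=A^*A:X\to X$, and $s_1\ge s_2\ge\dots$ are the singular numbers of $H$. Index function: a continuous, non-decreasing $\rho:(0,\infty)\to(0,\infty)$ with $\rho(0+)=0$ (extended by $\rho(0)=0$); companion $\Theta_\rho(t)=\sqrt t\,\rho(t)$. Source set: $H_\varphi=\{\varphi(H)v:\|v\|_X\le1\}$. Modulus of continuity: for $S\subset X$ and $\delta>0$, $\omega_{f_0}(H^{-1/2},S,\delta)=\sup\{\|f-f_0\|_X:\ f\in S,\ \|H^{1/2}(f-f_0)\|_X\le\delta\}$. Degree of approximation: $\varrho(K,\mathcal X_k)=\|K(I-P_k)\|$ (operator norm). Modulus of injectivity: $j(K,\mathcal X_k)=\inf_{0\ne h\in\mathcal X_k}\|Kh\|/\|h\|_X$. *)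

(* Defs.v *)
From HB Require Import structures.
From mathcomp Require Import all_boot all_order all_algebra.
From mathcomp Require Import all_classical all_reals all_analysis.
From mathcomp Require Import complex.

Set Implicit Arguments.
Unset Strict Implicit.
Unset Printing Implicit Defensive.

Import Order.TTheory GRing.Theory Num.Theory.
Import numFieldNormedType.Exports.

Local Open Scope classical_set_scope.
Local Open Scope ring_scope.

(* Real and complex Hilbert spaces are treated at once: the scalar field is R
   or R[i], according to the parameter. *)
Variant scalar_kind := RealScalars | ComplexScalars.

Definition scalar_field (R : realType) (s : scalar_kind) : numFieldType :=
  match s with RealScalars => R | ComplexScalars => R[i] end.

Definition scalar_conj (R : realType) (s : scalar_kind) :
    scalar_field R s -> scalar_field R s :=
  match s return scalar_field R s -> scalar_field R s with
  | RealScalars => id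
  | ComplexScalars => fun z : R[i] => z^*
  end.

Definition scalar_re (R : realType) (s : scalar_kind) : scalar_field R s -> R :=
  match s return scalar_field R s -> R with
  | RealScalars => id
  | ComplexScalars => fun z : R[i] => complex.Re z
  end.

Definition scalar_of_real (R : realType) (s : scalar_kind) : R -> scalar_field R s :=
  match s return R -> scalar_field R s with
  | RealScalars => id
  | ComplexScalars => fun x => x%:C%C
  end.

(* Norms in a normedModType K take their values in K; this is the same norm
   as an element of R. *)
Definition rnorm (R : realType) (s : scalar_kind)
    (V : normedModType (scalar_field R s)) (x : V) : R := scalar_re `|x|.

(* A Hilbert space is a complete normed space V together with an inner product
   (linear in the first argument) satisfying [hilbert_norm]. *)
Definition hilbert_norm (R : realType) (s : scalar_kind)
    (V : normedModType (scalar_field R s)) (dot : {dot V for @scalar_conj R s}) :=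
  forall x : V, `|x| ^+ 2 = dot x x.

Definition separable_space (T : topologicalType) :=
  exists D : set T, countable D /\ dense D.

Section Subspaces.
Context {R : realType} {s : scalar_kind} {V : normedModType (scalar_field R s)}.

(* S is a linear subspace of V of dimension n. *)
Definition subspace_dim (n : nat) (S : set V) :=
  exists b : 'I_n -> V,
    (forall c : 'I_n -> scalar_field R s,
       \sum_(i < n) c i *: b i = 0 -> forall i, c i = 0) /\
    S = [set x | exists c : 'I_n -> scalar_field R s, x = \sum_(i < n) c i *: b i].

Definition orth_proj (dot : {dot V for @scalar_conj R s}) (S : set V)
    (P : V -> V) :=
  forall x : V, S (P x) /\ forall h : V, S h -> dot (x - P x) h = 0.

End Subspaces.

Section Operators.
Context {R : realType} {s : scalar_kind}.

Definition compact_op (V W : normedModType (scalar_field R s)) (T : V -> W) :=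
  precompact (T @` [set x | `|x| <= 1]).

Definition adjoint_of (V W : normedModType (scalar_field R s))
    (dotV : {dot V for @scalar_conj R s}) (dotW : {dot W for @scalar_conj R s})
    (T : V -> W) (Tadj : W -> V) :=
  forall (x : V) (y : W), dotW (T x) y = dotV x (Tadj y).

(* The order of the scalar field makes [0 <= dot (B x) x] include, for complex
   scalars, that dot (B x) x is real. *)
Definition positive_sqrt (V : normedModType (scalar_field R s))
    (dot : {dot V for @scalar_conj R s}) (T B : V -> V) :=
  [/\ adjoint_of dot dot B B, forall x, 0 <= dot (B x) x &
      forall x, B (B x) = T x].

Context {V : normedModType (scalar_field R s)} (dot : {dot V for @scalar_conj R s}).

(* j-th largest eigenvalue, counted with multiplicity and starting at j = 1,
   of a compact positive self-adjoint operator T; the value at j = 0 is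
   meaningless. *)
Definition eigenvalue_nb (T : V -> V) (j : nat) : R :=
  sup [set t : R | exists (e : 'I_j -> V) (lam : 'I_j -> R),
    (forall i k, dot (e i) (e k) = (i == k)%:R) /\
    (forall i, T (e i) = scalar_of_real s (lam i) *: e i /\ t <= lam i)].

(* j-th singular number of the compact operator T with adjoint Tadj: the
   j-th eigenvalue of (Tadj T)^(1/2). *)
Definition singular_nb (T Tadj : V -> V) (j : nat) : R :=
  Num.sqrt (eigenvalue_nb (Tadj \o T) j).

Definition orthonormal_basis (e : nat -> V) :=
  (forall i k, dot (e i) (e k) = (i == k)%:R) /\
  forall x : V, (\sum_(0 <= i < n) dot x (e i) *: e i) @[n --> \oo] --> x.

(* w = phi(T) v, by the functional calculus of a diagonalizable self-adjoint
   operator T: phi(T) v = \sum_i phi(lam_i) <v, e_i> e_i. *)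
Definition is_fun_calc (phi : R -> R) (T : V -> V) (v w : V) :=
  exists (e : nat -> V) (lam : nat -> R),
    [/\ orthonormal_basis e,
        forall i, T (e i) = scalar_of_real s (lam i) *: e i &
        (\sum_(0 <= i < n)
           (scalar_of_real s (phi (lam i)) * dot v (e i)) *: e i)
          @[n --> \oo] --> w].

Definition source_set (phi : R -> R) (T : V -> V) : set V :=
  [set w | exists2 v, `|v| <= 1 & is_fun_calc phi T v w].

End Operators.

Section Functionals.
Context {R : realType} {s : scalar_kind} {V W : normedModType (scalar_field R s)}.

Definition op_norm (T : V -> W) : \bar R :=
  ereal_sup [set (rnorm (T x))%:E | x in [set x : V | `|x| <= 1]].

(* Degree of approximation ||T (I - P)|| of the range of the projection P. *)
Definition approx_degree (T : V -> W) (P : V -> V) : \bar R :=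
  op_norm (fun x => T (x - P x)).

Definition injectivity_modulus (T : V -> W) (S : set V) : \bar R :=
  ereal_inf [set (rnorm (T h) / rnorm h)%:E | h in S `\ 0].

(* Modulus of continuity at f0 of the inverse of T; -oo if the constraint set
   is empty. *)
Definition continuity_modulus (T : V -> W) (f0 : V) (S : set V) (delta : R) :
    \bar R :=
  ereal_sup [set (rnorm (f - f0))%:E |
             f in [set f | S f /\ rnorm (T (f - f0)) <= delta]].

End Functionals.

Section IndexFunctions.
Context {R : realType}.

Definition index_function (rho : R -> R) :=
  [/\ forall t, 0 < t -> 0 < rho t,
      forall t u, 0 < t -> t <= u -> rho t <= rho u,
      forall t, 0 < t -> {for t, continuous rho},
      rho t @[t --> 0^'+] --> (0 : R) &
      rho 0 = 0].

Definition companion (rho : R -> R) (t : R) : R := Num.sqrt t * rho t.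

(* Inverse of the bijection [companion rho] of the positive half-line. *)
Definition companion_inv (rho : R -> R) : R -> R :=
  'pinv_(fun=> 0) [set t : R | 0 < t] (companion rho).

(* max {j >= 1 : companion rho (s j) > delta}, and 0 if there is no maximum. *)
Definition cutoff (rho : R -> R) (s : nat -> R) (delta : R) : nat :=
  let A := [set j | (0 < j)%N /\ delta < companion rho (s j)] in
  xget 0%N [set k | A k /\ forall j, A j -> (j <= k)%N].

End IndexFunctions.

(* Main.v *)
Require Import Defs.
From HB Require Import structures.
From mathcomp Require Import all_boot all_order all_algebra.
From mathcomp Require Import all_classical all_reals all_analysis.
From mathcomp Require Import complex finmap ring lra.
Import Order.TTheory GRing.Theory Num.Theory.
Import numFieldNormedType.Exports.
Local Open Scope classical_set_scope.
Local Open Scope ring_scope.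

(** Write [k] for the cutoff at level [delta] and [t] for the companion
    inverse of [delta], so that [delta = sqrt t * phi t].  By maximality of
    [k], the companion of [s (k+1)] is at most [delta] and that of [s k] is
    larger than [delta]; as the companion is increasing,
    [s (k+1) <= t <= s k].

    Let [f] be an element of [Xk k] with [|Hhalf (f - f0)| <= delta], and split
    [f - f0] at the projection [P k f0].  The bias [f0 - P k f0] is at most
    [M * phi (s (k+1)) <= M * phi t].  The remaining part [f - P k f0] lies in
    [Xk k], where [Hhalf] is bounded below by [sqrt (s k) / CB], and its image
    is at most [delta + |Hhalf (f0 - P k f0)|].  Since [f0 - P k f0] is its own
    component orthogonal to [Xk k], the approximation degree applies to it once
    more, and the last norm is at most
    [CP * sqrt (s (k+1)) * M * phi (s (k+1))], which is [CP * M] times the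
    companion of [s (k+1)], hence at most [CP * M * delta].  Altogether
    [|f - f0| <= CB * (1 + CP * M) * delta / sqrt (s k) + M * phi t], and
    [delta / sqrt (s k) <= delta / sqrt t = phi t]: the constant
    [CB * (1 + CP * M) + M] works.  This is [continuity_modulus_bound]
    together with the estimates at the end of the main proof.

    The maximum defining [k] must exist for small [delta].  The set is bounded
    because [s j] tends to 0 ([eigenvalue_nb_small]): eigenvectors of [H^2]
    with eigenvalues above a fixed positive level have images under [A] that
    keep a fixed distance from each other, and the precompact image of the unit ball has room for finitely
    many of them only.  It is nonempty because [s 1 > 0]
    ([eigenvalue_nb1_gt0]): the functional calculus that represents [f0] comes
    with an orthonormal eigenbasis of [H], and [A] is injective.

    Real and complex scalars are handled together by passing to the real part
    of the inner product, a real inner product with the same norm. *)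

Set Implicit Arguments.
Unset Strict Implicit.
Unset Printing Implicit Defensive.

(** * Real parts of scalars *)

Section Scalars.
Context {R : realType} {sc : scalar_kind}.
Implicit Types (z w : scalar_field R sc) (a b : R).

Lemma scalar_re0 : scalar_re (0 : scalar_field R sc) = 0.
Proof. by case: sc. Qed.

Lemma scalar_re_nat n : scalar_re (n%:R : scalar_field R sc) = n%:R.
Proof. by case: sc => //=; rewrite -(rmorph_nat (real_complex R)). Qed.

Lemma scalar_reD z w : scalar_re (z + w) = scalar_re z + scalar_re w.
Proof. by case: sc z w => //= -[? ?] [? ?]. Qed.

Lemma scalar_reN z : scalar_re (- z) = - scalar_re z.
Proof. by case: sc z => //= -[? ?]. Qed.

Lemma scalar_reM a z : scalar_re (scalar_of_real sc a * z) = a * scalar_re z.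
Proof. by case: sc z => //= -[? ?] /=; rewrite mul0r subr0. Qed.

Lemma scalar_re_conj z : scalar_re (scalar_conj z) = scalar_re z.
Proof. by case: sc z => //= -[? ?]. Qed.

Lemma scalar_of_realM a b :
  scalar_of_real sc (a * b) = scalar_of_real sc a * scalar_of_real sc b.
Proof. by case: sc => //=; rewrite rmorphM. Qed.

Lemma scalar_of_reK z : 0 <= z -> scalar_of_real sc (scalar_re z) = z.
Proof. by case: sc z => //= -[? ?]; rewrite lecE /= => /andP[/eqP-> _]. Qed.

Lemma scalar_re_le z w : z <= w -> scalar_re z <= scalar_re w.
Proof. by case: sc z w => //= -[? ?] [? ?]; rewrite lecE => /andP[]. Qed.

Lemma ltr_scalar a b : (scalar_of_real sc a < scalar_of_real sc b) = (a < b).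
Proof. by case: sc => //=; rewrite ltcR. Qed.

End Scalars.

(** * The real-valued norm and the real inner product *)

Section RealNorm.
Context {R : realType} {sc : scalar_kind}.
Context {V : normedModType (scalar_field R sc)}.
Implicit Types x y : V.

Lemma scalar_rnorm x : scalar_of_real sc (rnorm x) = `|x|.
Proof. exact: scalar_of_reK. Qed.

Lemma rnorm_ge0 x : 0 <= rnorm x.
Proof. by rewrite -(scalar_re0 (sc := sc)); exact: scalar_re_le. Qed.

Lemma rnorm_eq0 x : rnorm x = 0 -> x = 0.
Proof.
move=> x0; apply/normr0_eq0; rewrite -scalar_rnorm x0.
by case: (sc).
Qed.

Lemma rnorm0 : rnorm (0 : V) = 0.
Proof. by rewrite /rnorm normr0 scalar_re0. Qed.

Lemma rnormD x y : rnorm (x + y) <= rnorm x + rnorm y.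
Proof. by rewrite -scalar_reD; exact/scalar_re_le/ler_normD. Qed.

Lemma rnormN x : rnorm (- x) = rnorm x.
Proof. by rewrite /rnorm normrN. Qed.

Lemma rnormZ a x : 0 <= a -> rnorm (scalar_of_real sc a *: x) = a * rnorm x.
Proof.
move=> a0; rewrite /rnorm normrZ ger0_norm ?scalar_reM//.
by case: (sc) => //=; rewrite lecR.
Qed.

Lemma rnorm_le1 x : (`|x| <= 1) = (rnorm x <= 1).
Proof.
rewrite -scalar_rnorm; case: (sc) (rnorm x) => //= r.
by rewrite -[1]/((1 : R)%:C%C) lecR.
Qed.

Lemma ball_rnorm x r y : ball x (scalar_of_real sc r) y -> rnorm (x - y) < r.
Proof. by rewrite -ball_normE /= -scalar_rnorm ltr_scalar. Qed.

End RealNorm.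

Section RealDot.
Context {R : realType} {sc : scalar_kind}.
Context {V : normedModType (scalar_field R sc)}.
Variable dot : {dot V for @scalar_conj R sc}.

(** The real part keeps symmetry, real linearity and the norm, and makes the
    form real-valued, so that estimates take place in the ordered field [R]. *)
Definition rdot (x y : V) : R := scalar_re (dot x y).

Lemma rdotBl x y z : rdot (x - y) z = rdot x z - rdot y z.
Proof. by rewrite /rdot linearBl scalar_reD scalar_reN. Qed.

Lemma rdotC x y : rdot x y = rdot y x.
Proof. by rewrite /rdot hermitian_subproof expr0 mul1r scalar_re_conj. Qed.

Lemma rdotBr x y z : rdot x (y - z) = rdot x y - rdot x z.
Proof. by rewrite rdotC rdotBl !(rdotC x). Qed.

Lemma rdotZl a x y : rdot (scalar_of_real sc a *: x) y = a * rdot x y.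
Proof. by rewrite /rdot linearZl_LR scalar_reM. Qed.

Lemma rdotZr a x y : rdot x (scalar_of_real sc a *: y) = a * rdot x y.
Proof. by rewrite rdotC rdotZl rdotC. Qed.

Hypothesis hdot : hilbert_norm dot.

Lemma rdot_norm x : rdot x x = rnorm x ^+ 2.
Proof.
rewrite /rdot -hdot expr2 -{1}scalar_rnorm scalar_reM.
by rewrite expr2.
Qed.

End RealDot.
(** * Compact operators and total boundedness *)

Section CompactOperators.
Context {R : realType} {sc : scalar_kind}.
Context {X Y : normedModType (scalar_field R sc)}.

(** Total boundedness of the image of the unit ball, from a finite subcover of
    the cover by all open balls of radius [r]. *)
Lemma compact_op_net (A : X -> Y) (r : R) : compact_op A -> 0 < r ->
  exists N : {fset Y}%fset, forall x, rnorm x <= 1 ->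
    exists2 y, y \in N & rnorm (y - A x) < r.
Proof.
move=> + r0; rewrite /compact_op precompactE compact_cover.
move=> /(_ Y setT (fun y => ball y (scalar_of_real sc r))).
case=> [y _|y _|N _ NA]; first exact: ball_open.
  exists y => //; apply: ballxx.
  by rewrite -(ltr_scalar (sc := sc)) in r0; case: (sc) r0.
exists N => x x1.
have /NA[y Ny /ball_rnorm ?] : closure (A @` [set x | `|x| <= 1]) (A x).
  by apply: subset_closure; exists x => //=; rewrite rnorm_le1.
by exists y.
Qed.

Lemma linear_bound (T : {linear X -> Y}) (c : R) :
    (forall x, rnorm x <= 1 -> rnorm (T x) <= c) ->
  forall x, rnorm (T x) <= c * rnorm x.
Proof.
move=> Tc x; have [x0|x0] := eqVneq (rnorm x) 0.
  by rewrite (rnorm_eq0 x0) linear0 !rnorm0 mulr0.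
have xgt0 : 0 < rnorm x by rewrite lt_neqAle eq_sym x0 rnorm_ge0.
have := Tc (scalar_of_real sc (rnorm x)^-1 *: x).
rewrite linearZ /= !rnormZ ?invr_ge0 ?rnorm_ge0// mulVf// => /(_ (lexx _)).
by rewrite mulrC ler_pdivrMr.
Qed.

Lemma compact_op_bounded (A : {linear X -> Y}) : compact_op A ->
  exists2 c : R, 0 < c & forall x, rnorm (A x) <= c * rnorm x.
Proof.
move=> /compact_op_net/(_ ltr01)[N NA].
exists (1 + \sum_(y <- N) rnorm y).
  by rewrite ltr_pwDl// sumr_ge0// => y _; exact: rnorm_ge0.
apply: linear_bound => x /NA[y Ny yA].
rewrite -[A x](subrK y) (le_trans (rnormD _ _))// lerD//.
  by rewrite -rnormN opprB ltW.
rewrite (big_rem y)//= lerDl sumr_ge0// => z _; exact: rnorm_ge0.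
Qed.

(** Two points whose images are [r] apart cannot share a point of an [r/2]-net,
    so the size of such a net bounds the number of points. *)
Lemma compact_op_separated (A : X -> Y) (r : R) : compact_op A -> 0 < r ->
  exists N : nat, forall (j : nat) (e : 'I_j -> X),
    (forall i, rnorm (e i) <= 1) ->
    (forall i k, i != k -> r <= rnorm (A (e i) - A (e k))) -> (j <= N)%N.
Proof.
move=> cA r0; have [N NA] := compact_op_net cA (divr_gt0 r0 (ltr0Sn R 1)).
(* [g] sends each index to a net point close to its image, and is injective. *)
exists #|` N|%fset => j e e1 eA.
have /choice[g gP] : forall i, exists y : N, rnorm (val y - A (e i)) < r / 2.
  by move=> i; have [y Ny yA] := NA _ (e1 i); exists [` Ny]%fset.
rewrite cardfE -[leqLHS]card_ord; apply: (@leq_card _ _ g) => i k gik.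
apply/eqP; apply: contraT => /eA; rewrite leNgt => /negP[].
have -> : A (e i) - A (e k) =
    (val (g k) - A (e k)) - (val (g i) - A (e i)).
  by rewrite gik opprB [RHS]addrC addrA subrK.
by rewrite (le_lt_trans (rnormD _ _))// rnormN [ltRHS]splitr ltrD.
Qed.

End CompactOperators.

(** * Eigenvalues of the square of [A^* A] *)

Section NormalOperator.
Context {R : realType} {sc : scalar_kind}.
Context {X Y : normedModType (scalar_field R sc)}.
Variables (dotX : {dot X for @scalar_conj R sc}).
Variables (dotY : {dot Y for @scalar_conj R sc}).
Hypotheses (hX : hilbert_norm dotX) (hY : hilbert_norm dotY).
Variables (A : {linear X -> Y}) (Aadj : Y -> X) (H : {linear X -> X}).
Hypothesis compA : compact_op A.
Hypothesis hAadj : adjoint_of dotX dotY A Aadj.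
Hypothesis hH : forall x, H x = Aadj (A x).

Lemma rdot_normal x y : rdot dotX (H x) y = rdot dotY (A x) (A y).
Proof. by rewrite rdotC [RHS]rdotC /rdot hAadj hH. Qed.

Lemma rdot_normal_sym x y : rdot dotX (H x) y = rdot dotX x (H y).
Proof. by rewrite rdot_normal rdotC -rdot_normal rdotC. Qed.

(** Transfers separation from the vectors [H x] to the vectors [A x].  With [c]
    a bound for [A], [<H x, H x> = <A x, A (H x)>]; the Cauchy-Schwarz argument
    for this product is carried out by expanding the square of
    [|A x - c^-2 A (H x)|], whose multiplier minimizes it after
    [|A (H x)| <= c |H x|]. *)
Lemma normal_bounded :
  exists2 c : R, 0 < c & forall x, rnorm (H x) <= c * rnorm (A x).
Proof.
have [c c0 Ac] := compact_op_bounded compA; exists c => // x.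
rewrite -ler_sqr ?nnegrE ?mulr_ge0 ?rnorm_ge0 ?(ltW c0)// exprMn.
have sq := sqr_ge0 (rnorm (A x - scalar_of_real sc (c ^- 2) *: A (H x))).
move: sq; rewrite -(rdot_norm hY) rdotBl !rdotBr !rdotZl !rdotZr.
rewrite (rdotC _ _ (A x)) -(rdot_normal x (H x)) !rdot_norm// => sq.
have AHx : rnorm (A (H x)) ^+ 2 <= c ^+ 2 * rnorm (H x) ^+ 2.
  by rewrite -exprMn ler_sqr ?nnegrE ?mulr_ge0 ?rnorm_ge0 ?(ltW c0).
have c20 : 0 < c ^+ 2 by rewrite exprn_gt0.
move: sq AHx.
set u := rnorm (A (H x)) ^+ 2; set v := rnorm (H x) ^+ 2.
set w := rnorm (A x) ^+ 2 => sq uv.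
rewrite -ler_pdivrMl//.
have : c ^- 2 * (c ^- 2 * u) <= c ^- 2 * v.
  by rewrite ler_wpM2l ?invr_ge0 ?(ltW c20)// ler_pdivrMl.
move: sq; set d := c ^- 2 => *; lra.
Qed.

(** The data under the supremum in [eigenvalue_nb], for the operator [H^2] whose
    eigenvalues are the squares of the singular numbers of [H]. *)
Definition eigenvalue_witness (j : nat) (t : R) (e : 'I_j -> X)
    (lam : 'I_j -> R) :=
  (forall i k, dotX (e i) (e k) = (i == k)%:R) /\
  (forall i, (H \o H) (e i) = scalar_of_real sc (lam i) *: e i /\ t <= lam i).

Section Witness.
Variables (j : nat) (t : R) (e : 'I_j -> X) (lam : 'I_j -> R).
Hypothesis he : eigenvalue_witness t e lam.

Lemma witness_rdot i k : rdot dotX (H (e i)) (H (e k)) = lam i * (i == k)%:R.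
Proof.
have [eo el] := he.
rewrite -rdot_normal_sym -[H (H _)]/((H \o H) _) (el i).1 rdotZl.
by rewrite /rdot eo scalar_re_nat.
Qed.

Lemma witness_norm i : rnorm (e i) = 1.
Proof.
apply/eqP; rewrite -sqrp_eq1 ?rnorm_ge0// -(rdot_norm hX) /rdot he.1 eqxx.
by rewrite (scalar_re_nat 1).
Qed.

(** The vectors [H (e i)] are orthogonal with squared norms [lam i], so
    Pythagoras gives [lam i + lam k] for the squared distance. *)
Lemma witness_separated i k : i != k ->
  2 * t <= rnorm (H (e i) - H (e k)) ^+ 2.
Proof.
move=> ik; rewrite -(rdot_norm hX) rdotBl !rdotBr !witness_rdot !eqxx.
rewrite (negPf ik) eq_sym (negPf ik) !mulr0 !mulr1 subr0 sub0r opprK.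
by rewrite mulrDl mul1r lerD// (he.2 _).2.
Qed.

End Witness.

(** The eigenvalues tend to 0: [j] eigenvectors with eigenvalues above [t] give
    [j] points of the unit ball whose images under [A] are separated by a
    distance independent of [j]. *)
Lemma eigenvalue_nb_small (t : R) : 0 < t ->
  exists N : nat, forall j, (N < j)%N -> eigenvalue_nb dotX (H \o H) j <= t.
Proof.
move=> t0; have [c c0 Hc] := normal_bounded.
have d0 : 0 < Num.sqrt (2 * t) / c by rewrite divr_gt0// sqrtr_gt0 mulr_gt0.
have [N NA] := compact_op_separated compA d0.
exists N => j Nj; rewrite /eigenvalue_nb; set E := [set _ | _].
(* The supremum of the empty set is 0; it occurs if there are fewer than [j]
   orthonormal eigenvectors. *)
have [->|/set0P E0] := eqVneq E set0; first by rewrite sup0 ltW.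
apply: ge_sup => // u [e [lam he]]; rewrite leNgt; apply/negP => tu.
move: Nj; rewrite ltnNge => /negP[]; apply: (NA _ e) => [i|i k ik].
  by rewrite (witness_norm he).
rewrite ler_pdivrMr// [leRHS]mulrC -linearB (le_trans _ (Hc _))//.
rewrite linearB -ler_sqr ?nnegrE ?sqrtr_ge0 ?rnorm_ge0//.
rewrite sqr_sqrtr ?mulr_ge0 ?(ltW t0)//.
rewrite (le_trans _ (witness_separated he ik))//.
by rewrite ler_pM2l// ltW.
Qed.

(** An eigenvector of [H] is one of [H^2], for the eigenvalue [lam ^+ 2], which
    is positive as [lam = |A e|^2].  The supremum is at least this value only
    because the set is bounded above, which is where boundedness of [H]
    enters. *)
Lemma eigenvalue_nb1_gt0 (e : X) (lam : R) : injective A ->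
  dotX e e = 1 -> H e = scalar_of_real sc lam *: e ->
  0 < eigenvalue_nb dotX (H \o H) 1.
Proof.
move=> injA e1 He; have [c c0 Hc] := normal_bounded.
have [b b0 Ab] := compact_op_bounded compA.
have lam0 : 0 < lam ^+ 2.
  rewrite exprn_even_gt0//=; apply/eqP => lam0.
  have e0 : e = 0.
    apply: injA; rewrite linear0; apply/rnorm_eq0/eqP.
    by rewrite -sqrf_eq0 -(rdot_norm hY) -rdot_normal He rdotZl lam0 mul0r.
  have := scalar_re_nat (R := R) (sc := sc) 1.
  by rewrite -e1 e0 linear0l scalar_re0 => /eqP; rewrite eq_sym oner_eq0.
apply: (lt_le_trans lam0); apply: ub_le_sup.
  exists ((c * b) ^+ 2) => t [f [mu hf]].
  have le_t : t <= rdot dotX (H (f ord0)) (H (f ord0)).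
    by rewrite (witness_rdot hf) eqxx mulr1 (hf.2 _).2.
  rewrite (le_trans le_t)// rdot_norm// ler_sqr ?nnegrE ?rnorm_ge0//.
    rewrite (le_trans (Hc _))// ler_pM2l// (le_trans (Ab _))//.
    by rewrite (witness_norm hf) mulr1.
  by rewrite mulr_ge0 ?ltW.
exists (fun=> e), (fun=> lam ^+ 2); split=> [i k|i].
  by rewrite !ord1 eqxx.
split=> //=; rewrite He linearZ /= He scalerA expr2.
by rewrite scalar_of_realM.
Qed.

End NormalOperator.
(** * Index functions and the cutoff *)

Section IndexFunctions.
Context {R : realType} (phi : R -> R).
Hypothesis hphi : index_function phi.

Local Notation Theta := (companion phi).

Lemma index_function_le (u t : R) : 0 <= u -> u <= t -> phi u <= phi t.
Proof.
have [phi_gt0 phi_le _ _ phi0] := hphi.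
rewrite le_eqVlt => /predU1P[<-|u0 ut]; last exact: phi_le.
by rewrite le_eqVlt => /predU1P[<-//|t0]; rewrite phi0 ltW// phi_gt0.
Qed.

Lemma index_function_ge0 (t : R) : 0 <= t -> 0 <= phi t.
Proof.
by have [_ _ _ _ phi0] := hphi => t0; rewrite -phi0 index_function_le.
Qed.

Lemma companion_le (u t : R) : 0 <= u -> u <= t -> Theta u <= Theta t.
Proof.
move=> u0 ut; rewrite ler_pM ?sqrtr_ge0 ?index_function_ge0//.
  exact: ler_wsqrtr.
exact: index_function_le.
Qed.

Lemma companion_lt (u t : R) : 0 < u -> u < t -> Theta u < Theta t.
Proof.
have [phi_gt0 _ _ _ _] := hphi => u0 ut; have t0 := lt_trans u0 ut.
rewrite (@lt_le_trans _ _ (Num.sqrt t * phi u))//.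
  by rewrite ltr_pM2r ?phi_gt0// ltr_sqrt.
by rewrite ler_wpM2l ?sqrtr_ge0// index_function_le// ltW.
Qed.

Lemma companion_gt0 (t : R) : 0 < t -> 0 < Theta t.
Proof.
by have [? _ _ _ _] := hphi => t0; rewrite mulr_gt0 ?sqrtr_gt0; auto.
Qed.

(** Intermediate values between [min 1 c] and [max 1 c], where [c] solves
    [sqrt c * phi 1 = d]: by monotonicity of [phi] the companion is at most
    [d] at the former and at least [d] at the latter. *)
Lemma companion_surj : set_surj [set t | 0 < t] [set d | 0 < d] Theta.
Proof.
have [phi_gt0 _ phi_cont _ _] := hphi.
move=> d /= d0; pose c := (d / phi 1) ^+ 2.
have phi1 := phi_gt0 _ ltr01.
have c0 : 0 < c by rewrite exprn_gt0// divr_gt0.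
have dE : d = Num.sqrt c * phi 1.
  by rewrite sqrtr_sqr gtr0_norm ?divr_gt0// divfK// gt_eqF.
pose a := Num.min 1 c; pose b := Num.max 1 c.
have a0 : 0 < a by rewrite lt_min ltr01.
have ab : a <= b by rewrite ge_min le_max lexx.
have ad : Theta a <= d.
  by rewrite dE ler_pM ?sqrtr_ge0 ?index_function_ge0 ?ler_wsqrtr
    ?index_function_le ?ge_min ?lexx ?orbT ?(ltW a0).
have db : d <= Theta b.
  by rewrite dE ler_pM ?sqrtr_ge0 ?index_function_ge0 ?ler_wsqrtr
    ?index_function_le ?le_max ?lexx ?orbT ?ler01.
have [||t tab <-] := @IVT R Theta a b d ab.
- apply: continuous_in_subspaceT => t /set_mem /=.
  rewrite in_itv/= => /andP[at_ _].
  apply: cvgM; first exact: sqrt_continuous.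
  exact: phi_cont (lt_le_trans a0 at_).
- by rewrite ge_min ad le_max db orbT.
exists t => //=; move: tab; rewrite in_itv/= => /andP[at_ _].
exact: lt_le_trans at_.
Qed.

Lemma companion_inv_gt0 (d : R) : 0 < d -> 0 < companion_inv phi d.
Proof.
move=> d0; have := surjpinv_image_sub (dflt := fun=> 0) companion_surj.
by move=> /(_ (companion_inv phi d)); apply; exists d.
Qed.

Lemma companion_invK (d : R) : 0 < d -> Theta (companion_inv phi d) = d.
Proof.
by move=> d0; apply: (surjpK _ companion_surj); exact: mem_set.
Qed.

Lemma le_companion_inv (d t : R) : 0 < d ->
  Theta t <= d -> t <= companion_inv phi d.
Proof.
move=> d0; apply: contraTT; rewrite -!ltNge -[X in X < Theta _]companion_invK//.
exact/companion_lt/companion_inv_gt0.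
Qed.

Lemma companion_inv_le (d t : R) : 0 < d -> 0 <= t ->
  d <= Theta t -> companion_inv phi d <= t.
Proof.
move=> d0 t0; apply: contraTT; rewrite -!ltNge => td.
rewrite -[ltRHS](companion_invK d0).
move: t0; rewrite le_eqVlt => /predU1P[t0|t0]; last exact: companion_lt.
  rewrite -{1}t0 /companion sqrtr0 mul0r.
  exact/companion_gt0/companion_inv_gt0.
Qed.

(** The maximum in the definition of the cutoff is attained, and the default
    value 0 avoided, as soon as the set is nonempty and bounded. *)
Lemma cutoffP (s : nat -> R) (d : R) (N : nat) : 0 < d -> d < Theta (s 1%N) ->
    (forall j, (N < j)%N -> Theta (s j) <= d) ->
  let k := cutoff phi s d in
  [/\ (0 < k)%N, d < Theta (s k) & Theta (s k.+1) <= d].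
Proof.
move=> d0 d1 sN /=; set k := cutoff _ _ _.
pose A := [set j | (0 < j)%N /\ d < Theta (s j)].
have AN j : `[< A j >] -> (j <= N)%N.
  by move=> /asboolP[_]; rewrite leqNgt; apply: contraTN => /sN; rewrite -leNgt.
have [m /asboolP Am mA] :=
  @ex_maxnP (fun j => `[< A j >]) N (ex_intro _ 1%N (asboolT (conj isT d1))) AN.
have [[k0 dk] kA] : A k /\ forall j, A j -> (j <= k)%N.
  rewrite /k /cutoff -/A.
  apply: (@xgetPex _ 0%N [set k | A k /\ forall j, A j -> (j <= k)%N]).
  by exists m; split=> // j Aj; apply/mA/asboolP.
split=> //; rewrite leNgt; apply/negP => dk1.
by have /kA : A k.+1 by []; rewrite ltnn.
Qed.

End IndexFunctions.
(** * The error bound on a finite-dimensional subspace *)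

Section Projections.
Context {R : realType} {sc : scalar_kind}.
Context {V W : normedModType (scalar_field R sc)}.

Lemma subspace_dimB n (S : set V) x y :
  subspace_dim n S -> S x -> S y -> S (x - y).
Proof.
move=> [b [_ ->]] [c ->] [d ->]; exists (fun i => c i - d i).
by rewrite -sumrB; apply: eq_bigr => i _; rewrite scalerBl.
Qed.

Lemma injectivity_modulus_le (T : {linear V -> W}) (S : set V) (c : R) h :
    (c%:E <= injectivity_modulus T S)%E -> S h ->
  c * rnorm h <= rnorm (T h).
Proof.
move=> cT Sh; have [->|h0] := eqVneq h 0.
  by rewrite linear0 !rnorm0 mulr0.
have hgt0 : 0 < rnorm h.
  rewrite lt_neqAle rnorm_ge0 andbT eq_sym.
  by apply: contra h0 => /eqP/rnorm_eq0->.
rewrite -ler_pdivlMr// -lee_fin (le_trans cT)//.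
by apply: ereal_inf_lbound; exists h => //; split=> //; exact/eqP.
Qed.

Variable dot : {dot V for @scalar_conj R sc}.
Hypothesis hdot : hilbert_norm dot.

Lemma orth_proj_eq0 (S : set V) (P : V -> V) x : orth_proj dot S P ->
  (forall h, S h -> rdot dot x h = 0) -> P x = 0.
Proof.
move=> hP xS; have [SPx /(_ _ SPx) xP] := hP x.
apply/rnorm_eq0/eqP; rewrite -sqrf_eq0 -(rdot_norm hdot) -oppr_eq0 -sub0r.
by rewrite -{1}(xS _ SPx) -rdotBl /rdot xP scalar_re0.
Qed.

(** The degree of approximation measures [T (I - P)] on all of [V]; as [P]
    vanishes on [y = x - P x], applying it to [y] in place of [x] gains the
    factor [|x - P x|] in place of [|x|]. *)
Lemma approx_degree_le (T : {linear V -> W}) (S : set V) (P : V -> V)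
    (c : R) x :
    orth_proj dot S P -> (approx_degree T P <= c%:E)%E ->
  rnorm (T (x - P x)) <= c * rnorm (x - P x).
Proof.
move=> hP Tc; set y := x - P x.
have yS h : S h -> rdot dot y h = 0.
  by move=> Sh; rewrite /rdot (hP x).2// scalar_re0.
have [y0|y0] := eqVneq (rnorm y) 0.
  by rewrite (rnorm_eq0 y0) linear0 !rnorm0 mulr0.
have ygt0 : 0 < rnorm y by rewrite lt_neqAle eq_sym y0 rnorm_ge0.
set z := scalar_of_real sc (rnorm y)^-1 *: y.
have Pz : P z = 0.
  by apply: orth_proj_eq0 hP _ => h Sh; rewrite rdotZl yS ?mulr0.
have z1 : `|z| <= 1 by rewrite rnorm_le1 rnormZ ?mulVf// invr_ge0 ltW.
rewrite mulrC -ler_pdivrMl// -rnormZ ?invr_ge0 ?(ltW ygt0)// -linearZ -/z.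
rewrite -lee_fin (le_trans _ Tc)//; apply: ereal_sup_ubound.
by exists z => //=; rewrite Pz subr0.
Qed.

End Projections.

(** Splitting [f - f0] at [P f0]: the component in [S] is controlled by the
    injectivity modulus, the other one by the bias. *)
Lemma continuity_modulus_bound (R : realType) (sc : scalar_kind)
    (V W : normedModType (scalar_field R sc))
    (dot : {dot V for @scalar_conj R sc}) (T : {linear V -> W})
    (n : nat) (S : set V) (P : V -> V) (f0 : V) (rho j bias delta : R) :
    hilbert_norm dot -> subspace_dim n S -> orth_proj dot S P ->
    0 < j -> 0 <= rho ->
    (approx_degree T P <= rho%:E)%E -> (j%:E <= injectivity_modulus T S)%E ->
    rnorm (f0 - P f0) <= bias ->
  (continuity_modulus T f0 S delta
   <= (j^-1 * (delta + rho * bias) + bias)%:E)%E.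
Proof.
move=> hdot hS hP j0 rho0 hrho hj hbias.
apply: ge_ereal_sup => _ [f [Sf fd] <-]; rewrite lee_fin.
rewrite -(subrK (P f0) f) -addrA (le_trans (rnormD _ _))// lerD//; last first.
  by rewrite -rnormN opprB.
rewrite ler_pdivlMl// (le_trans (injectivity_modulus_le hj _))//.
  by apply: (subspace_dimB hS Sf); have [] := hP f0.
have -> : f - P f0 = (f - f0) + (f0 - P f0) by rewrite addrA subrK.
rewrite linearD (le_trans (rnormD _ _))// lerD//.
by rewrite (le_trans (approx_degree_le hdot _ hP hrho))// ler_wpM2l.
Qed.

Theorem theorem3
  (R : realType) (sc : scalar_kind)
  (X Y : completeNormedModType (scalar_field R sc))
  (dotX : {dot X for @scalar_conj R sc}) (dotY : {dot Y for @scalar_conj R sc})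
  (hX : hilbert_norm dotX) (hY : hilbert_norm dotY)
  (sepX : separable_space X) (sepY : separable_space Y)
  (A : {linear X -> Y}) (compA : compact_op A) (injA : injective A)
  (rangeA : forall (n : nat) (S : set Y),
     subspace_dim n S -> ~ (range A `<=` S))
  (Aadj : {linear Y -> X}) (hAadj : adjoint_of dotX dotY A Aadj)
  (H : {linear X -> X}) (hH : forall x, H x = Aadj (A x))
  (Hhalf : {linear X -> X}) (hHhalf : positive_sqrt dotX H Hhalf)
  (s : nat -> R) (hs : forall j, (0 < j)%N -> s j = singular_nb dotX H H j)
  (phi : R -> R) (hphi : index_function phi)
  (f0 : X) (hf0 : source_set dotX phi H f0)
  (Xk : nat -> set X) (hXk : forall k, (0 < k)%N -> subspace_dim k (Xk k))
  (P : nat -> X -> X) (hP : forall k, (0 < k)%N -> orth_proj dotX (Xk k) (P k))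
  (M CP CB : R) (hM : 1 <= M) (hCP : 1 <= CP) (hCB : 1 <= CB)
  (happrox : forall k, (0 < k)%N ->
     (approx_degree Hhalf (P k) <= (CP * Num.sqrt (s k.+1))%:E)%E)
  (hinj : forall k, (0 < k)%N ->
     ((CB^-1 * Num.sqrt (s k))%:E <= injectivity_modulus Hhalf (Xk k))%E)
  (hbias : forall k, (0 < k)%N -> rnorm (f0 - P k f0) <= M * phi (s k.+1)) :
  exists C4 : R, \forall delta \near (0 : R)^'+,
    (continuity_modulus Hhalf f0 (Xk (cutoff phi s delta)) delta
     <= (C4 * phi (companion_inv phi delta))%:E)%E.
Proof.
have [phi_gt0 _ _ _ _] := hphi.
have s_ge0 j : (0 < j)%N -> 0 <= s j.
  by move=> j0; rewrite hs// /singular_nb sqrtr_ge0.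
have s1_gt0 : 0 < s 1%N.
  have [v _ [e [lam [[eo _] He _]]]] := hf0.
  rewrite hs// /singular_nb sqrtr_gt0.
  apply: (eigenvalue_nb1_gt0 hX hY compA hAadj hH injA _ (He 0%N)).
  by rewrite eo eqxx.
exists (CB * (1 + CP * M) + M); near=> delta.
have delta0 : 0 < delta by near: delta; exact: nbhs_right_gt.
have delta1 : delta < companion phi (s 1%N).
  by near: delta; apply: nbhs_right_lt; exact: companion_gt0.
set t := companion_inv phi delta.
have t0 : 0 < t by exact: companion_inv_gt0.
have tE : companion phi t = delta by exact: companion_invK.
(* Beyond [N], [s j ^+ 2 <= t ^+ 2] and thus the companion of [s j] is at most
   that of [t], which is [delta]. *)
have [N sN] := eigenvalue_nb_small hX hY compA hAadj hH (exprn_gt0 2 t0).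
have [|k0 dk dk1] := @cutoffP _ phi s delta N delta0 delta1.
  move=> j Nj; have j0 : (0 < j)%N by exact: leq_ltn_trans Nj.
  rewrite -tE companion_le ?s_ge0// hs// /singular_nb.
  by rewrite -(ger0_norm (ltW t0)) -sqrtr_sqr ler_wsqrtr// sN.
set k := cutoff phi s delta in k0 dk dk1 *.
have sk : t <= s k by apply: companion_inv_le; rewrite ?s_ge0// ltW.
have sk1 : s k.+1 <= t by exact: le_companion_inv.
have sk0 : 0 < s k by exact: lt_le_trans sk.
have CB0 : 0 < CB by exact: lt_le_trans hCB.
have CP0 : 0 < CP by exact: lt_le_trans hCP.
have M0 : 0 < M by exact: lt_le_trans hM.
apply: le_trans (continuity_modulus_bound delta hX (hXk k k0) (hP k k0) _ _
  (happrox k k0) (hinj k k0) (hbias k k0)) _.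
- by rewrite mulr_gt0 ?invr_gt0 ?sqrtr_gt0.
- by rewrite mulr_ge0 ?sqrtr_ge0 ?ltW.
rewrite lee_fin mulrDl lerD//; last first.
  by rewrite ler_pM2l// index_function_le// s_ge0.
(* The propagated bias is a multiple of the companion of [s k.+1 <= t]. *)
have -> : CP * Num.sqrt (s k.+1) * (M * phi (s k.+1)) =
    CP * M * companion phi (s k.+1) by rewrite /companion; ring.
rewrite invfM invrK -!mulrA ler_pM2l// ler_pdivrMl ?sqrtr_gt0//.
apply: (@le_trans _ _ ((1 + CP * M) * delta)).
  by rewrite mulrDl mul1r -mulrA lerD2l !ler_pM2l.
rewrite -[in leLHS]tE [leRHS]mulrCA ler_pM2l ?addr_gt0 ?mulr_gt0//.
by rewrite ler_pM2r ?phi_gt0// ler_wsqrtr.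
Unshelve. all: by end_near.
Qed.
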